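(* Let $\mathcal H,\mathcal G$ be separable Hilbert spaces, let $T\colon\mathcal H\to\mathcal G$ be bounded, let $N\in\mathbb N_0$, let $T_N\colon\mathcal H\to\mathcal G$ have rank at most $N$, and suppose that $E_N:=T-T_N$ is Hilbert--Schmidt. Then, for every $\tau>0$, $$n(\tau;T)\le N+\kappa\!\left(\frac{\|E_N\|_{\mathcal S_2}^2}{\tau^2}\right).$$
   Context: $n(\tau;T):=\operatorname{rank}\mathbf 1_{(\tau,\infty)}(|T|)$ with $|T|=(T^*T)^{1/2}$ (for compact $T$ this is the number of singular values strictly larger than $\tau$, with multiplicity). $\|\cdot\|_{\mathcal S_2}$ is the Hilbert--Schmidt norm. For $r\ge0$, $\kappa(r):=\max\{0,\lceil r\rceil-1\}$. *)

(* Defs.v *)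
From HB Require Import structures.
From mathcomp Require Import all_boot all_order all_algebra sesquilinear complex.
From mathcomp Require Import all_classical all_reals all_analysis.

Set Implicit Arguments.
Unset Strict Implicit.
Unset Printing Implicit Defensive.

Import Order.TTheory GRing.Theory Num.Theory.
Import numFieldNormedType.Exports.

Local Open Scope classical_set_scope.
Local Open Scope ring_scope.

(* A complex Hilbert space: a complete normed space over R[i] whose norm comes
   from an inner product, linear in its first and conjugate-linear in its second
   argument.  No dimension restriction: finite-dimensional spaces are included. *)
HB.mixin Record CompleteNormedModule_isHilbert (R : realType) (H : Type)
    of CompleteNormedModule R[i] H := {
  hdot : {dot H for (@Num.conj R[i])} ;
  hdot_norm : forall x : H, `|x| ^+ 2 = hdot x x
}.

#[short(type="hilbertType")]
HB.structure Definition Hilbert (R : realType) :=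
  { H of CompleteNormedModule_isHilbert R H & CompleteNormedModule R[i] H }.

Definition separable (T : topologicalType) : Prop :=
  exists D : set T, countable D /\ dense D.

(* The library norm of a complex normed space has values in R[i]. *)
Definition hnorm (R : realType) (H : hilbertType R) (x : H) : R :=
  complex.Re `|x|.

Section Operators.
Context {R : realType}.
Implicit Types H G : hilbertType R.

Definition bounded_op H G (T : H -> G) : Prop :=
  exists M : R, forall x, hnorm (T x) <= M * hnorm x.

Definition lin_indep (V : lmodType R[i]) (k : nat) (v : 'I_k -> V) : Prop :=
  forall a : 'I_k -> R[i], \sum_i a i *: v i = 0 -> forall i, a i = 0.

(* Dimension (a natural number or +oo) of the range of a linear map: the
   supremum of the sizes of the linearly independent families in the range. *)
Definition rank H G (T : H -> G) : \bar R :=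
  ereal_sup [set (k%:R)%:E | k in
    [set k : nat | exists v : 'I_k -> H, lin_indep (T \o v)]].

Definition is_adjoint H G (T : H -> G) (S : G -> H) : Prop :=
  forall x y, hdot (T x) y = hdot x (S y).

(* The following three notions are definite descriptions.  For bounded T, resp.
   bounded self-adjoint A, the described object exists and is unique (for
   spectral_measure: unique on Borel sets), so the default is never used. *)
Definition adjoint H G (T : H -> G) : G -> H :=
  xget (fun=> 0) [set S | is_adjoint T S].

(* |T| = (T^* T)^{1/2} *)
Definition absop H G (T : H -> G) : H -> H :=
  xget (fun=> 0)
    [set A | [/\ linear A, bounded_op A, is_adjoint A A,
                 (forall x, 0 <= hdot (A x) x) &
                 A \o A = adjoint T \o T]].

Definition orthoproj H (P : H -> H) : Prop :=
  [/\ linear P, P \o P = P & is_adjoint P P].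

(* E is the projection-valued measure on the Borel sets of R representing A:
   for each x the set function mu_x : B |-> <E(B) x, x> is a measure, and
   <A x, x> = \int l d(mu_x)(l), i.e. A = \int l dE(l).  (By polarization the
   diagonal x = y determines everything.)  The values of E on non-Borel sets
   are irrelevant. *)
Definition is_spectral_measure H (A : H -> H) (E : set R -> H -> H) : Prop :=
  [/\ (forall B : set R, measurable B -> orthoproj (E B)),
      E setT = id,
      (forall B C : set R, measurable B -> measurable C ->
         E (B `&` C) = E B \o E C) &
      (forall x : H, exists mu : {measure set R -> \bar R},
         [/\ (forall B : set R, measurable B ->
                mu B = (complex.Re (hdot (E B x) x))%:E),
             mu.-integrable setT (fun l : R => l%:E) &
             (\int[mu]_l l%:E)%E = (complex.Re (hdot (A x) x))%:E])].

Definition spectral_measure H (A : H -> H) : set R -> H -> H :=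
  xget (fun _ => fun=> 0) [set E | is_spectral_measure A E].

(* n(tau; T) = rank 1_{(tau, oo)}(|T|) *)
Definition sing_count (tau : R) H G (T : H -> G) : \bar R :=
  rank (spectral_measure (absop T) `]tau, +oo[).

Definition is_onb H (B : set H) : Prop :=
  [/\ (forall e, B e -> hdot e e = 1),
      (forall e f, B e -> B f -> e <> f -> hdot e f = 0) &
      dense [set x | exists (k : nat) (a : 'I_k -> R[i]) (e : 'I_k -> H),
               (forall i, B (e i)) /\ x = \sum_i a i *: e i]].

(* Squared Hilbert-Schmidt norm, possibly +oo: the value of the sum of the
   ||S e||^2 over an orthonormal basis; by Parseval it is the same for all
   bases. *)
Definition hs_norm2 H G (S : H -> G) : \bar R :=
  xget +oo%E
    [set s | exists B : set H, is_onb B /\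
             s = \esum_(e in B) ((hnorm (S e)) ^+ 2)%:E].

Definition hilbert_schmidt H G (S : H -> G) : Prop :=
  [/\ linear S, bounded_op S & (hs_norm2 S < +oo)%E].

Definition hs_norm H G (S : H -> G) : R := Num.sqrt (fine (hs_norm2 S)).

Definition kappa (r : R) : int := Num.max 0 (Num.ceil r - 1).

End Operators.

(* Main.v *)
From HB Require Import structures.
Require Import Defs.
From mathcomp Require Import all_boot all_order all_algebra sesquilinear complex.
From mathcomp Require Import all_classical all_reals all_analysis.
From mathcomp Require Import zify ring lra.

(* On the range of the spectral projection of |T| for (tau, oo) every nonzero v
   satisfies |T v| > tau |v|.  If this range had dimension at least N + m with
   m >= 1, it would contain orthonormal u_1, ..., u_m in the kernel of T_N, for
   which |E_N u_j| = |T u_j| > tau; since orthonormal families satisfy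
   \sum_j |E_N u_j|^2 <= |E_N|_HS^2, this forces m < |E_N|_HS^2 / tau^2.
   No existence theorem for the spectral measure, |T| or T^* is needed.  Without
   a spectral measure the projection defaults to 0, of rank 0; if |T| or T^*
   defaults to 0, then <|T| v, v> > tau |v|^2 or |(|T| v)| > tau |v| rules out
   any nonzero v in the range. *)

Import Order.TTheory GRing.Theory Num.Theory.
Import numFieldNormedType.Exports.

Local Open Scope classical_set_scope.
Local Open Scope ring_scope.

Section SingularValueCount.
Set Implicit Arguments.
Unset Strict Implicit.
Context {R : realType}.
Implicit Types H G : hilbertType R.

(** * Inner product and real-valued norm *)

Lemma hdotC H (x y : H) : hdot x y = (hdot y x)^*.
Proof. by rewrite hermC expr0 mul1r. Qed.

Lemma hnormE H (x : H) : (hnorm x)%:C%C = `|x|.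
Proof. by rewrite /hnorm RRe_real // ger0_real. Qed.

Lemma hnorm_ge0 H (x : H) : 0 <= hnorm x.
Proof. by rewrite -lecR hnormE normr_ge0. Qed.

Lemma hnorm_gt0 H (x : H) : x <> 0 -> 0 < hnorm x.
Proof. by move=> /eqP x0; rewrite -ltcR hnormE normr_gt0. Qed.

Lemma re_hdot H (x : H) : complex.Re (hdot x x) = hnorm x ^+ 2.
Proof. by rewrite -hdot_norm -hnormE -rmorphXn. Qed.

(** * Strict lower bounds on the spectral range of |T| *)

(** All the mass sits on (tau, oo), where l - tau is positive. If its integral were 0 it would
    vanish almost everywhere, and (tau, oo) would be a null set despite its mass m > 0. *)
Lemma integral_id_gt (mu : {measure set R -> \bar R}) (tau m : R) :
  mu `]-oo, tau]%classic = 0%E -> mu setT = m%:E -> 0 < m ->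
  mu.-integrable setT (fun l : R => l%:E) ->
  ((tau * m)%:E < \int[mu]_l l%:E)%E.
Proof.
move=> mu0 muT m0 il.
have mC : measurable (`]tau, +oo[%classic : set R) by exact: measurable_itv.
have mA : measurable (`]-oo, tau]%classic : set R) by exact: measurable_itv.
have CE : setT `\` `]-oo, tau]%classic = `]tau, +oo[%classic :> set R.
  by rewrite setTD setCitvl.
have muC : mu `]tau, +oo[%classic = m%:E.
  have : mu (`]-oo, tau]%classic `|` `]tau, +oo[%classic) =
      (mu `]-oo, tau]%classic + mu `]tau, +oo[%classic)%E.
    by apply: (measureU mu mA mC); rewrite -CE setTD setICr.
  by rewrite mu0 -CE setTD setUv add0e muT => ->.
have ilC : mu.-integrable `]tau, +oo[%classic (fun l : R => l%:E).
  by apply: (@integrableS _ _ _ mu setT).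
have ic : mu.-integrable `]tau, +oo[%classic (cst tau%:E).
  apply/integrableP; split; first exact: measurable_cst.
  by rewrite /= integral_cst // muC ltry.
rewrite (negligible_integral mA) // CE.
have dE := integralB mC ilC ic.
rewrite integral_cst // muC in dE.
have fE : (\int[mu]_(x in `]tau, +oo[) x%:E)%E \is a fin_num.
  exact: integrable_fin_num.
rewrite -sube_gt0 -dE.
rewrite lt0e; apply/andP; split; last first.
  apply: integral_ge0 => x /=; rewrite in_itv/= andbT => tx.
  by rewrite -EFinB lee_fin subr_ge0 ltW.
apply/eqP => i0.
have mf := measurable_int mu (integrableB mC ilC ic).
have [+ _] := ae_eq_integral_abs mu mC mf.
case.
  rewrite -[RHS]i0; apply: eq_integral => x.
  rewrite inE /= in_itv/= andbT => tx.
  by rewrite ger0_norm // subr_ge0 ltW.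
move=> A [mA' A0 DA].
have : (mu `]tau, +oo[%classic <= mu A)%E.
  apply: le_measure; rewrite ?inE // => x Dx.
  apply: DA => /= /(_ Dx) /eqP; rewrite -EFinB eqe subr_eq0 => /eqP xt.
  by move: Dx; rewrite /= xt in_itv /= ltxx.
by rewrite A0 muC lee_fin leNgt m0.
Qed.

(** The measure mu_v has total mass |v|^2 and none on (-oo, tau]: there E(-oo, tau] v = E(-oo, tau]
    E(tau, oo) v = E(set0) v, and <E(set0) v, v> = mu_v(set0) = 0. *)
Lemma spectral_range_gt H (A : H -> H) (E : set R -> H -> H) (tau : R) (v : H) :
  is_spectral_measure A E -> E `]tau, +oo[%classic v = v -> v <> 0 ->
  tau * hnorm v ^+ 2 < complex.Re (hdot (A v) v).
Proof.
move=> [_ ET EI /(_ v)[mu [muE il iE]]] Ev v0.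
have mC : measurable (`]tau, +oo[%classic : set R) by exact: measurable_itv.
have mA : measurable (`]-oo, tau]%classic : set R) by exact: measurable_itv.
rewrite -lte_fin -iE; apply: integral_id_gt => //.
- have EE : E `]-oo, tau]%classic v = E set0 v.
    rewrite -{1}Ev -[LHS]/((E `]-oo, tau]%classic \o E `]tau, +oo[%classic) v).
    by rewrite -EI // -setCitvl setICr.
  by rewrite (muE _ mA) EE -muE // measure0.
- by rewrite muE // ET re_hdot.
- by rewrite exprn_gt0 // hnorm_gt0.
Qed.

(** With A = |T|, expanding |A v - tau v|^2 >= 0 turns <A v, v> > tau |v|^2 into |A v| > tau |v|;
    then A^2 = T^* T passes from A v to T v. *)
Lemma absop_range_gt H G (T : H -> G) (E : set R -> H -> H) (tau : R) (v : H) :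
  0 < tau ->
  is_spectral_measure (absop T) E -> E `]tau, +oo[%classic v = v -> v <> 0 ->
  tau * hnorm v < hnorm (T v).
Proof.
move=> tau0 sE Ev v0.
have := spectral_range_gt sE Ev v0.
set A := absop T => lt1.
have vpos := hnorm_gt0 v0.
have lt2 : tau ^+ 2 * hnorm v ^+ 2 < hnorm (A v) ^+ 2.
  have : hnorm (A v - tau%:C%C *: v) ^+ 2 =
      hnorm (A v) ^+ 2 - 2 * tau * complex.Re (hdot (A v) v) +
      tau ^+ 2 * hnorm v ^+ 2.
    rewrite -!re_hdot linearBl /= !linearBr /= !linearZl_LR /= !linearZr_LR /=.
    rewrite (hdotC v (A v)).
    case: (hdot (A v) v) (hdot v v) (hdot (A v) (A v)) => [a b] [c d] [e f] /=.
    rewrite /GRing.scale /=; ring.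
  have := sqr_ge0 (hnorm (A v - tau%:C%C *: v)).
  nra.
(* This is an equality when |T| and T^* exist. If [absop T] is the default 0, the left side is 0; if
   only [adjoint T] is, then A (A v) = 0 contradicts [lt2]. *)
have Tv : hnorm (A v) ^+ 2 <= hnorm (T v) ^+ 2.
  rewrite -!re_hdot.
  move: lt1 lt2; rewrite /A /absop; case: xgetP => [A' _ [_ _ sA _ AA]|_ _].
    rewrite -(re_hdot (A' v)) (sA v (A' v)) => _.
    have -> : A' (A' v) = adjoint T (T v) by rewrite -[LHS]/((A' \o A') v) AA.
    rewrite /adjoint; case: xgetP => [S _ adj|_] /=.
      by rewrite -(adj v (T v)).
    by rewrite linear0r /= ltNge mulr_ge0 ?sqr_ge0.
  by rewrite linear0l (re_hdot (T v)) sqr_ge0.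
have := hnorm_ge0 (T v).
nra.
Qed.

(** * Finite orthonormal families and their projections *)

(* Finite families are indexed by nat; only the values below p matter. *)
Definition orthonormal_upto H p (y : nat -> H) :=
  forall i j, (i < p)%N -> (j < p)%N -> hdot (y i) (y j) = (i == j)%:R.

Definition oproj H p (y : nat -> H) (x : H) : H :=
  \sum_(i < p) hdot x (y i) *: y i.

Lemma hdot_oproj H p (y : nat -> H) (x : H) j : orthonormal_upto p y ->
  (j < p)%N -> hdot (oproj p y x) (y j) = hdot x (y j).
Proof.
move=> oy jp; rewrite /oproj linear_sumlz (bigD1 (Ordinal jp)) //=.
rewrite linearZl_LR /= oy // eqxx mulr1 big1 ?addr0 // => i ij.
rewrite linearZl_LR /= oy //.
case: eqP => [e|_]; last by rewrite mulr0.
by case/eqP: ij; apply: val_inj.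
Qed.

Lemma norm_sum_orthonormal H p (y : nat -> H) (a : 'I_p -> R[i]) :
  orthonormal_upto p y ->
  `|\sum_(i < p) a i *: y i| ^+ 2 = \sum_(i < p) `|a i| ^+ 2.
Proof.
move=> oy; rewrite hdot_norm linear_sumlz; apply: eq_bigr => i _.
rewrite linear_sumr (bigD1 i) //= linearZl_LR /= linearZr_LR /= oy // eqxx.
rewrite mulr1 big1 ?addr0 ?normCK // => j ji.
rewrite linearZr_LR linearZl_LR /= oy //.
case: eqP => [e|_]; last by rewrite !mulr0.
by case/eqP: ji; apply: val_inj.
Qed.

Lemma oproj_pythagoras H p (y : nat -> H) (x : H) : orthonormal_upto p y ->
  `|x| ^+ 2 = `|oproj p y x| ^+ 2 + `|x - oproj p y x| ^+ 2.
Proof.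
move=> oy; rewrite !hdot_norm -hnormDd ?subrKC //=.
rewrite {1}/oproj linear_sumlz big1 // => i _.
rewrite linearZl_LR /= (hdotC (y i)) linearBl /= hdot_oproj //.
by rewrite subrr rmorph0 mulr0.
Qed.

Lemma bessel H p (y : nat -> H) (x : H) : orthonormal_upto p y ->
  \sum_(i < p) `|hdot x (y i)| ^+ 2 <= `|x| ^+ 2.
Proof.
move=> oy; rewrite -(norm_sum_orthonormal _ oy).
by rewrite (oproj_pythagoras x oy) lerDl exprn_ge0.
Qed.

Lemma oproj_id H p (y : nat -> H) j : orthonormal_upto p y -> (j < p)%N ->
  oproj p y (y j) = y j.
Proof.
move=> oy jp; rewrite /oproj (bigD1 (Ordinal jp)) //= oy // eqxx scale1r.
rewrite big1 ?addr0 // => i ij; rewrite oy //.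
case: eqP => [e|_]; last by rewrite scale0r.
by case/eqP: ij; apply: val_inj.
Qed.

Lemma oproj_sum H p (y : nat -> H) (I : finType) (a : I -> R[i]) (x : I -> H) :
  oproj p y (\sum_i a i *: x i) = \sum_i a i *: oproj p y (x i).
Proof.
rewrite /oproj; under [RHS]eq_bigr do rewrite scaler_sumr.
rewrite exchange_big; apply: eq_bigr => i _.
rewrite linear_sumlz scaler_suml; apply: eq_bigr => j _.
by rewrite linearZl_LR scalerA.
Qed.

Lemma oprojB H p (y : nat -> H) (x z : H) :
  oproj p y (x - z) = oproj p y x - oproj p y z.
Proof.
by rewrite /oproj -sumrB; apply: eq_bigr => i _; rewrite linearBl scalerBl.
Qed.

(** Since z is fixed by the projection, x and x - z have the same residual, which Pythagoras bounds
    by |x - z|. *)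
Lemma oproj_best H p (y : nat -> H) (x z : H) :
  orthonormal_upto p y -> oproj p y z = z -> `|x - oproj p y x| <= `|x - z|.
Proof.
move=> oy zy.
have -> : x - oproj p y x = (x - z) - oproj p y (x - z).
  by rewrite oprojB zy opprB addrA subrK.
rewrite -(@ler_pXn2r _ 2) ?nnegrE //.
by rewrite [leRHS](oproj_pythagoras _ oy) lerDr exprn_ge0.
Qed.

Definition append_unit H p (y : nat -> H) (r : H) (n : nat) : H :=
  if n == p then `|r|^-1 *: r else y n.

Lemma append_unitE H p (y : nat -> H) r i :
  (i < p)%N -> append_unit p y r i = y i.
Proof. by rewrite /append_unit ltn_neqAle => /andP[/negPf->]. Qed.

Lemma orthonormal_append H p (y : nat -> H) r :
  orthonormal_upto p y -> r != 0 -> (forall i, (i < p)%N -> hdot r (y i) = 0) ->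
  orthonormal_upto p.+1 (append_unit p y r).
Proof.
move=> oy r0 ry.
have y'p : append_unit p y r p = `|r|^-1 *: r by rewrite /append_unit eqxx.
move=> i j; rewrite !ltnS leq_eqVlt => /predU1P[->|ip];
  rewrite leq_eqVlt => /predU1P[->|jp].
- rewrite y'p linearZl_LR linearZr_LR /= -hdot_norm.
  rewrite conj_Creal ?realV ?normr_real //.
  by rewrite eqxx expr2 mulKf ?mulVf // normr_eq0.
- by rewrite y'p append_unitE // linearZl_LR /= ry // mulr0 gtn_eqF.
- rewrite y'p append_unitE // hdotC linearZl_LR /= ry //.
  by rewrite mulr0 rmorph0 ltn_eqF.
- by rewrite !append_unitE // oy.
Qed.

(** Membership in the span of y is expressed as being fixed by [oproj p y]. The list s may be
    dependent, so p may be smaller than its size. The subspace V keeps y inside a given range, which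
    later bounds p by a rank. *)
Lemma gram_schmidt H (V : set H) (s : seq H) :
  V 0 -> (forall a x z, V x -> V z -> V (a *: x + z)) ->
  (forall x, x \in s -> V x) ->
  exists p, exists y : nat -> H, [/\ orthonormal_upto p y,
    forall i, (i < p)%N -> V (y i) & forall x, x \in s -> oproj p y x = x].
Proof.
move=> V0 Vl; elim: s => [|x s IH] sV.
  by exists 0%N, (fun=> 0); split.
have [|p [y [oy Vy sy]]] := IH.
  by move=> z zs; apply: sV; rewrite inE zs orbT.
have Vx : V x by apply: sV; rewrite mem_head.
pose r := x - oproj p y x.
have [r0|r0] := eqVneq r 0.
  exists p, y; split => // z; rewrite inE => /predU1P[->|/sy//].
  by apply/esym/eqP; rewrite -subr_eq0 -/r r0.
have Vp : V (oproj p y x).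
  rewrite /oproj; apply: (big_ind V) => // [a b Va Vb|i _].
    by rewrite -[a]scale1r; apply: Vl.
  by rewrite -[X in V X]addr0; apply: Vl => //; apply: Vy.
have Vr : V r by rewrite /r addrC -scaleN1r; apply: Vl.
have ry i : (i < p)%N -> hdot r (y i) = 0.
  by move=> ip; rewrite /r linearBl /= hdot_oproj // subrr.
pose e := `|r|^-1 *: r.
pose y' := append_unit p y r.
have y'p : y' p = e by rewrite /y' /append_unit eqxx.
have oprojE z : oproj p.+1 y' z = oproj p y z + hdot z e *: e.
  rewrite /oproj big_ord_recr /= y'p; congr (_ + _).
  by apply: eq_bigr => i _; rewrite /y' append_unitE.
exists p.+1, y'; split; first exact: orthonormal_append.
- move=> i; rewrite ltnS leq_eqVlt => /predU1P[->|ip];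
    last by rewrite /y' append_unitE //; apply: Vy.
  by rewrite y'p /e -[X in V X]addr0; apply: Vl.
(* As e is orthogonal to the old span, the coefficient of x along e is <r, e> = |r|. *)
- have yr z : hdot (oproj p y z) e = 0.
    rewrite /e linearZr_LR /= hdotC /oproj linear_sumr.
    rewrite big1 ?rmorph0 ?mulr0 // => i _.
    by rewrite linearZr_LR /= ry // mulr0.
  move=> z; rewrite inE => /predU1P[->|zs]; rewrite oprojE.
    have -> : hdot x e = `|r|.
      rewrite -[x](subrKC (oproj p y x)) linearDl /= yr add0r -/r.
      rewrite /e linearZr_LR /= -hdot_norm conj_Creal ?realV ?normr_real //.
      by rewrite expr2 mulrA mulVf ?mul1r // normr_eq0.
    by rewrite /e scalerA mulfV ?normr_eq0 // scale1r /r subrKC.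
  by rewrite sy // -{2}(sy _ zs) yr scale0r addr0.
Qed.

(** * Images of orthonormal families, kernels and rank *)

(* Expand all images in an orthonormal family y.  On the span of e each
   functional <S _, y_l> is <_, z_l> with |z_l|^2 = \sum_i |<S e_i, y_l>|^2, so
   Bessel for u gives the inequality for every l. *)
Lemma sum_norm_image_oproj H G (S : {linear H -> G}) m n (u e : nat -> H) :
  orthonormal_upto m u -> orthonormal_upto n e ->
  \sum_(j < m) `|S (oproj n e (u j))| ^+ 2 <= \sum_(i < n) `|S (e i)| ^+ 2.
Proof.
move=> ou oe.
pose s := [seq S (e i) | i <- iota 0 n] ++
  [seq S (oproj n e (u j)) | j <- iota 0 m].
have [//|//|//|p [y [oy _ sy]]] := @gram_schmidt _ setT s.
have norm_s x : x \in s -> `|x| ^+ 2 = \sum_(l < p) `|hdot x (y l)| ^+ 2.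
  by move=> xs; rewrite -{1}(sy x xs) norm_sum_orthonormal.
have es (i : 'I_n) : S (e i) \in s.
  rewrite mem_cat; apply/orP; left.
  by apply: (map_f (fun i => S (e i))); rewrite mem_iota /=.
have us (j : 'I_m) : S (oproj n e (u j)) \in s.
  rewrite mem_cat; apply/orP; right.
  by apply: (map_f (fun j => S (oproj n e (u j)))); rewrite mem_iota /=.
under eq_bigr => j _ do rewrite norm_s //.
under [leRHS]eq_bigr => i _ do rewrite norm_s //.
rewrite exchange_big [leRHS]exchange_big; apply: ler_sum => l _ /=.
pose z := \sum_(i < n) (hdot (S (e i)) (y l))^* *: e i.
have -> : \sum_(i < n) `|hdot (S (e i)) (y l)| ^+ 2 = `|z| ^+ 2.
  rewrite /z norm_sum_orthonormal //.
  by apply: eq_bigr => i _; rewrite norm_conjC.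
apply: le_trans (bessel z ou); rewrite le_eqVlt; apply/orP; left; apply/eqP.
apply: eq_bigr => j _; rewrite [in RHS]hdotC norm_conjC; congr (`|_| ^+ 2).
rewrite /oproj linear_sum linear_sumlz /z linear_sumr; apply: eq_bigr => i _.
by rewrite linearZ_LR linearZl_LR linearZr_LR /= conjCK mulrC.
Qed.

(* One vector at a time: a combination of the w_i killed by T and orthogonal
   to u_0, ..., u_(m-1) solves p + m < k linear equations. *)
Lemma orthonormal_in_kernel H G (T : {linear H -> G}) k p (w : 'I_k -> H)
    (y : nat -> G) :
  lin_indep w -> (forall i, oproj p y (T (w i)) = T (w i)) ->
  forall m, (m + p <= k)%N -> exists u : nat -> H,
    orthonormal_upto m u /\
    forall j, (j < m)%N ->
      T (u j) = 0 /\ exists a : 'I_k -> R[i], u j = \sum_i a i *: w i.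
Proof.
move=> lw yT; elim=> [|m IH] mk; first by exists (fun=> 0).
have [|u [ou Tu]] := IH; first exact: ltnW.
pose M : 'M[R[i]]_(k, p + m) :=
  row_mx (\matrix_(i, l) hdot (T (w i)) (y l))
         (\matrix_(i, j) hdot (w i) (u j)).
have : kermx M != 0.
  rewrite kermx_eq0 /row_free neq_ltn (leq_ltn_trans (rank_leq_col M)) //.
  by rewrite addnC.
move=> /rowV0Pn[c /sub_kermxP cM c0].
pose x := \sum_i c 0 i *: w i.
have x0 : x != 0.
  apply: contra c0 => /eqP/lw ci0; apply/eqP/rowP => i.
  by rewrite ci0 mxE.
move: cM; rewrite mul_mx_row => /eqP.
rewrite row_mx_eq0 => /andP[/eqP c1 /eqP c2].
have Tx : T x = 0.
  have -> : T x = oproj p y (T x).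
    rewrite linear_sum /=; under eq_bigr do rewrite linearZ_LR.
    by rewrite oproj_sum; apply: eq_bigr => i _; rewrite yT.
  rewrite /oproj big1 // => l _.
  have /rowP/(_ l) := c1; rewrite !mxE => cl.
  suff -> : hdot (T x) (y l) = 0 by rewrite scale0r.
  rewrite linear_sum linear_sumlz -[RHS]cl; apply: eq_bigr.
  by move=> i _; rewrite linearZ_LR linearZl_LR mxE.
have xu j : (j < m)%N -> hdot x (u j) = 0.
  move=> jm; have /rowP/(_ (Ordinal jm)) := c2; rewrite !mxE => cl.
  rewrite linear_sumlz -[RHS]cl; apply: eq_bigr => i _.
  by rewrite linearZl_LR mxE.
exists (append_unit m u x); split; first exact: orthonormal_append.
move=> j; rewrite ltnS leq_eqVlt => /predU1P[->|jm].
  rewrite /append_unit eqxx linearZ_LR Tx scaler0; split=> //.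
  exists (fun i => `|x|^-1 * c 0 i); rewrite /x scaler_sumr.
  by apply: eq_bigr => i _; rewrite scalerA.
by rewrite append_unitE //; apply: Tu.
Qed.

Lemma orthonormal_rank H G (T : {linear H -> G}) p (y : nat -> G) :
  orthonormal_upto p y -> (forall i, (i < p)%N -> range T (y i)) ->
  (p%:R%:E <= rank T)%E.
Proof.
move=> oy Ty.
have /choice[v vy] : forall i : 'I_p, exists x, T x = y i.
  by move=> i; have [x _ <-] := Ty _ (ltn_ord i); exists x.
apply: ereal_sup_ubound; exists p => //; exists v => a.
rewrite (eq_bigr (fun i : 'I_p => a i *: y i)); last first.
  by move=> i _; rewrite /= vy.
move=> ay0 i; have := norm_sum_orthonormal a oy.
rewrite ay0 normr0 expr0n /= => /esym/psumr_eq0P.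
move=> /(_ (fun i _ => exprn_ge0 2 (normr_ge0 _)))/(_ i isT)/eqP.
by rewrite expf_eq0 /= normr_eq0 => /eqP.
Qed.

(** * Comparison with the Hilbert-Schmidt norm *)

Lemma orthonormal_nth H (F : seq H) (B : set H) : is_onb B -> uniq F ->
  (forall e, e \in F -> B e) -> orthonormal_upto (size F) (nth 0 F).
Proof.
move=> [B1 B0 _] uF FB i j iF jF.
have [->|ij] := eqVneq i j; first by rewrite B1 //; apply/FB/mem_nth.
apply: B0; try exact/FB/mem_nth.
by apply/eqP; rewrite nth_uniq.
Qed.

(** Density gives a finite combination z of B close to x, and F lists its basis vectors. Any larger
    F' still fixes z, so its projection of x is at least as close. Allowing every F' lets one list
    serve several vectors x. *)
Lemma onb_oproj_gt H G (S : {linear H -> G}) (B : set H) (tau : R) (x : H) :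
  bounded_op S -> is_onb B -> tau < hnorm (S x) ->
  exists F : seq H, (forall e, e \in F -> B e) /\
    forall F', uniq F' -> (forall e, e \in F' -> B e) -> {subset F <= F'} ->
      tau < hnorm (S (oproj (size F') (nth 0 F') x)).
Proof.
move=> [M SM] onbB tauS; have [_ _ Bd] := onbB.
(* Chosen so that |x - P x| < d forces |S (x - P x)| < |S x| - tau. M may be negative or zero, hence
   [|M| + 1]. *)
pose d := (hnorm (S x) - tau) / (`|M| + 1).
have M0 : 0 < `|M| + 1 by rewrite ltr_wpDl.
have d0 : 0 < d by rewrite divr_gt0 // subr_gt0.
have dC : 0 < d%:C%C :> R[i] by rewrite ltcR.
have [||z [xz [k [a [e [eB zE]]]]]] := Bd (ball x d%:C%C).
- by exists x; apply: ballxx.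
- exact: ball_open.
exists [seq e i | i : 'I_k]; split=> [f /mapP[i _ ->] //|F' uF' BF' FF'].
have oF' := orthonormal_nth onbB uF' BF'.
set P := oproj _ _.
have Pz : P z = z.
  rewrite zE /P oproj_sum; apply: eq_bigr => i _; congr (_ *: _).
  have eF' : e i \in F' by apply: FF'; apply: map_f; rewrite mem_enum.
  by rewrite -(nth_index 0 eF') oproj_id // index_mem.
have xP : hnorm (x - P x) < d.
  rewrite -ltcR hnormE; apply: le_lt_trans (oproj_best x oF' Pz) _.
  by move: xz; rewrite -ball_normE.
have SxP : hnorm (S x) <= hnorm (S (P x)) + hnorm (S (x - P x)).
  rewrite -lecR rmorphD /= !hnormE linearB addrC.
  by rewrite -[X in `|X| <= _](subrK (S (P x))) ler_normD.
have := SM (x - P x); have := hnorm_ge0 (x - P x).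
have : d * (`|M| + 1) = hnorm (S x) - tau by rewrite divfK // gt_eqF.
have := ler_norm M.
nra.
Qed.

(** A single finite part F of B is used, with every |S (P u_j)| still above tau; without a limit,
    the inequality stays strict. *)
Lemma sum_onb_gt H G (S : {linear H -> G}) (B : set H) (tau : R) m
    (u : nat -> H) :
  bounded_op S -> is_onb B -> 0 <= tau -> (0 < m)%N -> orthonormal_upto m u ->
  (forall j, (j < m)%N -> tau < hnorm (S (u j))) ->
  ((m%:R * tau ^+ 2)%:E < \esum_(e in B) (hnorm (S e) ^+ 2)%:E)%E.
Proof.
move=> bS onbB tau0 m0 ou Su.
have /choice[f fP] (j : 'I_m) := onb_oproj_gt bS onbB (Su j (ltn_ord j)).
pose F := undup (flatten [seq f j | j : 'I_m]).
have FB e : e \in F -> B e.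
  rewrite mem_undup => /flatten_mapP[j _ ej]; exact: (fP j).1.
have uF : uniq F by exact: undup_uniq.
have fF j : {subset f j <= F}.
  move=> e ej; rewrite mem_undup; apply/flatten_mapP.
  by exists j; rewrite ?mem_enum.
have oF := orthonormal_nth onbB uF FB.
apply: (@lt_le_trans _ _ (\sum_(e <- F) (hnorm (S e) ^+ 2)%:E)%E); last first.
  apply: esum_ge; exists [set` F].
    by split=> //= e; apply: FB.
  by rewrite -fsbig_seq.
rewrite sumEFin lte_fin.
have le1 : \sum_(j < m) hnorm (S (oproj (size F) (nth 0 F) (u j))) ^+ 2 <=
    \sum_(e <- F) hnorm (S e) ^+ 2.
  rewrite (big_nth 0) big_mkord -lecR !rmorph_sum /=.
  under eq_bigr do rewrite rmorphXn /= hnormE.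
  under [leRHS]eq_bigr do rewrite rmorphXn /= hnormE.
  exact: sum_norm_image_oproj.
apply: lt_le_trans le1.
rewrite mulrC mulr_natr -[X in _ *+ X]card_ord -sumr_const.
apply: ltr_sum.
  by apply/hasP; exists (Ordinal m0); rewrite ?mem_index_enum.
move=> j _; have ltS := (fP j).2 F uF FB (fF j).
by rewrite ltr_pXn2r ?nnegrE // ltW // (le_lt_trans tau0).
Qed.

Lemma sum_hs_norm_gt H G (S : {linear H -> G}) (tau : R) m (u : nat -> H) :
  hilbert_schmidt S -> 0 <= tau -> (0 < m)%N -> orthonormal_upto m u ->
  (forall j, (j < m)%N -> tau < hnorm (S (u j))) ->
  m%:R * tau ^+ 2 < hs_norm S ^+ 2.
Proof.
move=> [_ bS]; rewrite /hs_norm /hs_norm2.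
(* The default [+oo] is excluded by finiteness, so the value is the sum over some basis B. *)
case: xgetP => [s _ [B [onbB ->]] sfin|//] tau0 m0 ou Su.
have s0 : (0 <= \esum_(e in B) (hnorm (S e) ^+ 2)%:E)%E.
  by apply: esum_ge0 => e _; rewrite lee_fin sqr_ge0.
rewrite sqr_sqrtr ?fine_ge0 // -lte_fin fineK ?ge0_fin_numE //.
exact: sum_onb_gt ou Su.
Qed.

(** * Dimension count and conclusion *)

Lemma kappa_ge0 (r : R) : 0 <= kappa r.
Proof. by rewrite /kappa le_max lexx. Qed.

(** A strict m < r gives m + 1 <= ceil r; strictness accounts for the [- 1] in [kappa]. *)
Lemma lt_kappa (m : nat) (r : R) : m%:R < r -> m%:Z <= kappa r.
Proof.
move=> mr; rewrite /kappa le_max; apply/orP; right.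
by rewrite lerBrDr addrC lez1D ceil_gt_int.
Qed.

(** F plays the spectral projection. Being killed by [TN] costs at most N of the k dimensions, which
    leaves k - N orthonormal vectors with |E_N u_j| > tau. *)
Lemma independent_family_bound H G (F : H -> H) (T TN : {linear H -> G})
    (N k : nat) (tau : R) (v : 'I_k -> H) :
  linear F -> F \o F = F ->
  (forall x, F x = x -> x <> 0 -> tau * hnorm x < hnorm (T x)) ->
  (rank TN <= N%:R%:E)%E -> hilbert_schmidt (T \- TN) -> 0 < tau ->
  lin_indep (F \o v) ->
  k%:Z <= N%:Z + kappa (hs_norm (T \- TN) ^+ 2 / tau ^+ 2).
Proof.
move=> linF FF FT rN hsS tau0 lv.
have [kN|Nk] := leqP k N.
  by rewrite -[k%:Z]addr0 lerD ?kappa_ge0 // lez_nat.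
pose FL : {linear H -> H} := HB.pack F (GRing.isLinear.Build _ _ _ _ F linF).
pose w := F \o v.
have [|||p [y [oy Vy yw]]] :=
    @gram_schmidt _ (range TN) [seq TN (w i) | i : 'I_k].
- by exists 0; rewrite ?linear0.
- by move=> a _ _ [x _ <-] [z _ <-]; exists (a *: x + z); rewrite ?linearP.
- by move=> _ /mapP[i _ ->]; exists (w i).
have pN : (p <= N)%N.
  by have := le_trans (orthonormal_rank oy Vy) rN; rewrite lee_fin ler_nat.
have yTN i : oproj p y (TN (w i)) = TN (w i).
  by apply: yw; apply: (map_f (fun i => TN (w i))); rewrite mem_enum.
have mk : (k - N + p <= k)%N by lia.
have [u [ou uP]] := orthonormal_in_kernel lv yTN mk.
have Su j : (j < k - N)%N -> tau < hnorm ((T \- TN) (u j)).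
  move=> jm; have [TNu [a uE]] := uP j jm.
  have uu := ou j j jm jm; rewrite eqxx in uu.
  have u0 : u j <> 0.
    by move=> e; move: uu; rewrite e linear0l => /eqP; rewrite eq_sym oner_eq0.
  have hu : hnorm (u j) = 1.
    apply/eqP; rewrite -sqrp_eq1 -?re_hdot ?uu //.
    exact: hnorm_ge0.
  have Fu : F (u j) = u j.
    rewrite uE -[F]/(FL : H -> H) linear_sum; apply: eq_bigr => i _.
    rewrite linearZ_LR /=; congr (_ *: _).
    by rewrite -[LHS]/((F \o F) (v i)) FF.
  by rewrite /= TNu subr0; have := FT _ Fu u0; rewrite hu mulr1.
have m0 : (0 < k - N)%N by rewrite subn_gt0.
have := sum_hs_norm_gt hsS (ltW tau0) m0 ou Su.
rewrite -ltr_pdivlMr ?exprn_gt0 // => /lt_kappa.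
rewrite -[X in hs_norm X]/(T \- TN); set K := kappa _; lia.
Qed.

Lemma spectral_measureP H (A : H -> H) :
  is_spectral_measure A (spectral_measure A) \/
  spectral_measure A = (fun _ => fun=> 0).
Proof. by rewrite /spectral_measure; case: xgetP => [E _|]; [left|right]. Qed.

End SingularValueCount.

Theorem lemma2p4 (R : realType) (H G : hilbertType R)
    (sepH : separable H) (sepG : separable G)
    (T : {linear H -> G}) (hT : bounded_op T)
    (N : nat) (TN : {linear H -> G}) (hTN : (rank TN <= (N%:R)%:E)%E)
    (hE : hilbert_schmidt (T \- TN))
    (tau : R) (htau : 0 < tau) :
  (sing_count tau T <=
     (N%:R)%:E + ((kappa (hs_norm (T \- TN) ^+ 2 / tau ^+ 2))%:~R)%:E)%E.
Proof.
rewrite /sing_count /rank.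
apply: ge_ereal_sup => _ [k [v lv] <-].
rewrite -EFinD lee_fin -[N%:R]/(N%:~R) -[k%:R]/(k%:~R) -intrD ler_int.
have [sE|E0] := spectral_measureP (absop T).
  have [PE _ _ _] := sE.
  have mC : measurable (`]tau, +oo[%classic : set R) by exact: measurable_itv.
  have [linF FF _] := PE _ mC.
  have ET x := @absop_range_gt _ _ _ T _ tau x htau sE.
  by have := independent_family_bound linF FF ET hTN hE htau lv.
(* For the default projection 0 only the empty family has independent images: coefficients all equal
   to 1 refute any other. *)
rewrite E0 in lv; case: k v lv => [|k] v lv.
  by rewrite addr_ge0 ?kappa_ge0.
have /eqP : 1 = 0 :> R[i].
  by apply: (lv (fun=> 1)) ord0; rewrite big1 // => i _; rewrite scaler0.
by rewrite oner_eq0.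
Qed.
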